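(* Let $n\geq 2$, $q=p^h$ with $p$ prime and $h\geq 2$, and $1\leq k\leq n-1$. Suppose that $p\geq 11$, $q^k\geq 239$, and let $\delta=\frac{q^k}{200}-\theta_{k-1}-\frac32$. Let $\mathcal{H}(n,n-k,q)$ be the hypergraph whose vertices are the points of $\mathrm{PG}(n,q)$ and whose hyperedges are the $(n-k)$-dimensional subspaces. Then any rainbow-free strict $N$-coloring of $\mathcal{H}(n,n-k,q)$ with \[N\geq \theta_n-2\theta_k+1-\delta\] has a monochromatic $2$-transversal, i.e., a color class meeting every $(n-k)$-dimensional subspace in at least two points.
   Context: For a hypergraph $\mathcal{H}=(V;E)$, a strict $N$-coloring is a partition of $V$ into exactly $N$ nonempty color classes. A hyperedge is rainbow if no two of its vertices have the same color; a coloring is rainbow-free if no hyperedge is rainbow. A $2$-transversal is a vertex set meeting every hyperedge in at least $2$ vertices. Dimensions are projective, and $\theta_m=\frac{q^{m+1}-1}{q-1}$ is the number of points of an $m$-dimensional projective space of order $q$. *)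

(* Defs.v *)
From HB Require Import structures.
From mathcomp Require Import all_boot all_order all_algebra.

Set Implicit Arguments.
Unset Strict Implicit.
Unset Printing Implicit Defensive.

Import Order.TTheory GRing.Theory Num.Theory.

Section Hypergraph.

                                                                     
                                                                         
Variable V : finType.
Implicit Types (E P : {set {set V}}) (e T : {set V}).

                                                      
Definition strict_coloring (N : nat) P : bool :=
  partition P [set: V] && (#|P| == N).

Definition rainbow P e : bool :=
  [forall x in e, forall y in e, (x != y) ==> (pblock P x != pblock P y)].

Definition rainbow_free E P : bool := [forall e in E, ~~ rainbow P e].

Definition two_transversal E T : bool := [forall e in E, 2 <= #|T :&: e|].

End Hypergraph.

                                                                         
                                               
Section FiniteSubspaces.

Import VectorInternalTheory.

Variables (F : finFieldType) (W : vectType F).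

HB.instance Definition _ := [Countable of {vspace W} by <:].
HB.instance Definition _ := [Finite of {vspace W} by <:].

End FiniteSubspaces.

                                                                         
                                                                   
Section ProjectiveSpace.

Variables (F : finFieldType) (n : nat).

Definition pg_subspace (m : nat) (U : {vspace 'rV[F]_n.+1}) : bool :=
  \dim U == m.+1.

Definition pg_point := {U : {vspace 'rV[F]_n.+1} | pg_subspace 0 U}.

HB.instance Definition _ := SubFinite.on pg_point.

Definition pg_points (U : {vspace 'rV[F]_n.+1}) : {set pg_point} :=
  [set x : pg_point | (val x <= U)%VS].

                                   
Definition pg_hypergraph (m : nat) : {set {set pg_point}} :=
  [set pg_points U | U : {vspace 'rV[F]_n.+1} & pg_subspace m U].

End ProjectiveSpace.

Definition theta (q m : nat) : rat := ((q%:R ^+ m.+1 - 1) / (q%:R - 1))%R.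

Definition delta (q k : nat) : rat :=
  (q%:R ^+ k / 200%:R - theta q k.-1 - 3%:R / 2%:R)%R.

(* Main.v *)
Require Import Defs.
From mathcomp Require Import all_boot all_order all_algebra.
From mathcomp Require Import all_fingroup all_field.
From mathcomp Require Import ring lra zify.

(** Let K be the extension of F of degree k, of order Q = q^k.  The
    (n-k)-subspaces of PG(n,q) are the traces of hyperplanes of PG(n,K), so it
    suffices to study K-linear functionals A on the points, each of which
    vanishes at two points of the same color.  A random functional vanishes at
    one given point with probability 1/Q and at two given points with
    probability 1/Q^2; thus a class of size s has two zeros with probability at
    most min(s(s-1)/(2Q^2), s/(2Q)).  As the excess sum of (|C| - 1) is at most
    2.02 Q, either the excess outside the largest class C1 is at most 0.3 Q, or
    there are two classes of size about Q.  The latter is excluded by second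
    moments: the numbers (a, b) of zeros in these classes would be (2, 0) or
    (0, 2) almost always, against E[ab] close to 1.

    In the former case let M be a minimal set with two zeros of every
    functional among the points in classes of size at least two.  A Jamison
    type argument shows that a point y of M lies on at least 3Q - 1 - |M|
    functionals of a pencil that have just two zeros in M.  If y is not in C1,
    each of them has a further zero in C1 \ M or outside C1, and there are too
    few such points.  So M is contained in C1. *)

Set Implicit Arguments.
Unset Strict Implicit.
Unset Printing Implicit Defensive.

Import Order.TTheory GRing.Theory Num.Theory.

(** * Numerical inequalities for the counting arguments *)

(** For [b > 0] the product is absorbed by [4ab <= a^2 + 4b^2]; equality at [(2, 0)] and [(2, 1)]
    makes 12 sharp. *)
Lemma count_pair_ge2 (a b : nat) : 1 < a ->
  12 + a * b <= 4 * (a * (a - 1)) + 4 * (b * (b - 1)) + 2 * a + 2 * b.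
Proof.
move=> a1; have a2 : 2 * a <= a * a by rewrite leq_mul2r a1 orbT.
have Em (n : nat) : n * (n - 1) + n = n * n.
  by case: n => // n; rewrite subSS subn0 mulnS addnC.
have ha := Em a; have hb := Em b; clear Em.
case: b hb => [|b] hb; first by lia.
have ab := nat_Cauchy a (2 * b.+1).
have b2 : b.+1 <= b.+1 * b.+1 by rewrite leq_pmulr.
rewrite -!mulnn in ab.
move: ab b2 hb; set c := b.+1; clearbody c => ab b2 hb; nia.
Qed.

(* The form 4 a (a - 1) + 4 b (b - 1) + 2 a + 2 b - a b equals 12 at (2, 0) and
   (0, 2), while its expectation for two classes of size Q is about 11. *)
Lemma count_pair_cover (a b : nat) (t : bool) : [|| t, 1 < a | 1 < b] ->
  12 + a * b <= 4 * (a * (a - 1)) + 4 * (b * (b - 1)) + 2 * a + 2 * b + 12 * t.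
Proof.
case/or3P => h.
- rewrite h; have [a1|a1] := leqP a 1; last by have := count_pair_ge2 b a1; lia.
  have [b1|b1] := leqP b 1; last by have := count_pair_ge2 a b1; lia.
  by case: a b a1 b1 => [|[|a]] [|[|b]].
- by have := count_pair_ge2 b h; lia.
by have := count_pair_ge2 a h; lia.
Qed.

(** The [s1], ..., [s5] are sums over all [o] functionals: zeros in either class, mixed pairs,
    ordered pairs in either class. Multiplied by [q ^ 2] they become multiples of [o], which
    cancels; [b] counts the exceptional functionals. *)
Lemma weighted_count_arith (c d b q o s1 s2 s3 s4 s5 R : nat) :
    2 * b * q ^ 2 <= R * o -> 0 < o -> 0 < q ->
    s1 * q = d * o -> s2 * q = c * o -> s3 * q ^ 2 = c * d * o ->
    s4 * q ^ 2 = d * (d - 1) * o -> s5 * q ^ 2 = c * (c - 1) * o ->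
    o * 12 + s3 <= 4 * s5 + 4 * s4 + 2 * s2 + 2 * s1 + 12 * b ->
  12 * q ^ 2 + c * d
    <= 4 * (c * (c - 1)) + 4 * (d * (d - 1)) + 2 * q * (c + d) + 6 * R.
Proof.
move=> hb o0 q0 h1 h2 h3 h4 h5 h.
have e1 : s1 * q ^ 2 = q * d * o by rewrite expnS expn1 mulnA h1; lia.
have e2 : s2 * q ^ 2 = q * c * o by rewrite expnS expn1 mulnA h2; lia.
have q2 : 0 < q ^ 2 by rewrite expn_gt0 q0.
rewrite -(leq_pmul2r o0).
have := leq_mul h (leqnn (q ^ 2)).
move: (q ^ 2) hb h3 h4 h5 e1 e2 => w hb h3 h4 h5 e1 e2; clear h h1 h2.
move: (c - 1) (d - 1) h4 h5 => c1 d1 h4 h5.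
lia.
Qed.

(** The constant comes from [2 / 2.02 > 0.99]. *)
Lemma largest_class_arith (q d s : nat) : 0 < q ->
  100 * d + 200 <= 202 * q -> 2 * q ^ 2 <= s * d -> 99 * q <= 100 * s.
Proof.
move=> q0 dq sd; have : 100 * (s * d) <= s * (202 * q).
  by rewrite mulnCA leq_mul2l; apply/orP; right; lia.
rewrite mulnCA => h; have : 200 * q * q <= 202 * s * q by lia.
by rewrite leq_pmul2r //; lia.
Qed.

(** Indeed [s + 2y <= d + 1 + 3r <= (2.02 + 0.9) q - 1]. *)
Lemma dominant_class_arith (q d r s y : nat) :
    100 * d + 200 <= 202 * q -> d = s - 1 + r -> y <= 2 * r ->
    10 * r <= 3 * q ->
  s + 2 * y < 3 * q.
Proof. by lia. Qed.

Lemma linear_count_arith (q r s1 s2 n1 n2 o : nat) : 0 < q -> 0 < o ->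
    2 * n1 * q <= s1 * o -> 2 * n2 * q ^ 2 <= s2 * r * o -> o <= n1 + n2 ->
  2 * q ^ 2 <= s1 * q + s2 * r.
Proof.
move=> q0 o0 h1 h2 h; rewrite -(leq_pmul2r o0).
have := leq_mul h1 (leqnn q); have := leq_mul h (leqnn (q ^ 2)).
by rewrite -!mulnn in h2 *; lia.
Qed.

(** As [s1 + r < 2.02 q], the last hypothesis gives [r (q - s2) < 0.02 q^2]; with [r > 0.3 q] this
    forces [q - s2 < q / 15]. *)
Lemma second_class_arith (q d r s1 s2 : nat) : 0 < q ->
    100 * d + 200 <= 202 * q -> d = s1 - 1 + r -> 3 * q < 10 * r ->
    2 * q ^ 2 <= s1 * q + s2 * r -> 14 * q <= 15 * s2.
Proof.
move=> q0 dq dE rq h; rewrite leqNgt; apply/negP => s2q.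
have s1q : 100 * (s1 + r) * q <= 202 * q * q.
  by rewrite leq_mul2r; apply/orP; right; lia.
have : 15 * (s2 * r) <= 14 * (q * r).
  by rewrite !mulnA leq_mul2r (ltnW s2q) orbT.
have : 3 * (q * q) < 10 * (r * q) by rewrite !mulnA ltn_pmul2r.
by rewrite -!mulnn in h *; lia.
Qed.

(** At [s1 = s2 = q], [r' = 0] the leading coefficients are 12 and 13; the size bounds keep the two
    sides apart. *)
Lemma two_class_arith (q d r r' s1 s2 : nat) :
    100 * d + 200 <= 202 * q -> d = s1 - 1 + r -> r = s2 - 1 + r' ->
    99 * q <= 100 * s1 -> 14 * q <= 15 * s2 ->
  4 * (s1 * (s1 - 1)) + 4 * (s2 * (s2 - 1)) + 2 * q * (s1 + s2)
    + 6 * ((r' + 1) * r') < 12 * q ^ 2 + s1 * s2.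
Proof.
move=> dq dE rE h1 h2; pose t := s1 + s2.
have q0 : 0 < q by lia.
have tq : 100 * t + 100 * r' <= 202 * q by rewrite /t; lia.
have rq : 10 * r' <= q by rewrite /t in tq; lia.
have p1 : 100 * (t * t) <= 202 * (q * t).
  by rewrite !mulnA leq_mul2r; apply/orP; right; lia.
have p2 : 100 * (q * t) <= 202 * (q * q).
  by rewrite mulnC (mulnC 202) -!mulnA leq_mul2l; apply/orP; right; lia.
have p3 : 10 * (r' * r') <= q * r' by rewrite mulnA leq_mul2r rq orbT.
have p4 : 10 * (q * r') <= q * q by rewrite mulnCA leq_mul2l rq orbT.
(* Expanding [(15 s1 - 14 q)(15 s2 - 14 q) >= 0] bounds [s1 s2] from below. *)
have p5 : 210 * (q * t) <= 225 * (s1 * s2) + 196 * (q * q).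
  have [a aE] : exists a, 15 * s1 = 14 * q + a by exists (15 * s1 - 14 * q); lia.
  have [b bE] : exists b, 15 * s2 = 14 * q + b by exists (15 * s2 - 14 * q); lia.
  have : (15 * s1) * (15 * s2) = (14 * q + a) * (14 * q + b) by rewrite aE bE.
  have : 15 * (q * t) = q * (28 * q + a + b).
    by rewrite mulnCA /t; congr (_ * _); lia.
  lia.
have e1 : s1 * (s1 - 1) + s1 = s1 * s1.
  by rewrite addnC -mulnS subn1 prednK //; lia.
have e2 : s2 * (s2 - 1) + s2 = s2 * s2.
  by rewrite addnC -mulnS subn1 prednK //; lia.
have q2 : 0 < q * q by rewrite muln_gt0 q0.
rewrite -mulnn; rewrite /t in p1 p2 p5; lia.
Qed.

Local Open Scope ring_scope.

(** * Power sums over a finite field and double covers of the affine plane *)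

Section FiniteFieldSums.

Variable K : finFieldType.

(** Translation by 1 permutes the field and so preserves the sum of its elements. *)
Lemma natr_card_finField : #|K|%:R = 0 :> K.
Proof.
suff: \sum_(x : K) x + #|K|%:R = \sum_(x : K) x.
  by move=> /(canRL (addKr _)); rewrite addNr.
rewrite [RHS](reindex_inj (addIr (1 : K))) big_split /= sumr_const.
by [].
Qed.

(** For [j > 0] the polynomial [X^j - 1] has too few roots to contain all nonzero elements; scaling
    by a nonroot [x] multiplies the sum by [x^j] and preserves it. *)
Lemma sum_expr_finField_small (j : nat) :
  (j < #|K|.-1)%N -> \sum_(x : K) x ^+ j = 0.
Proof.
move=> jQ; case: j jQ => [|j] jQ.
  under eq_bigr do rewrite expr0.
  by rewrite sumr_const natr_card_finField.
have [x x0 xj]: exists2 x : K, x != 0 & x ^+ j.+1 != 1.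
  apply/exists_inP; apply: contraLR jQ => /exists_inPn allx.
  have p0 : ('X^(j.+1) - 1 : {poly K}) != 0%R by rewrite monic_neq0 ?monicXnsubC.
  have := @max_poly_roots _ _ (enum (predC1 (0 : K))) p0.
  rewrite size_XnsubC // -cardE cardC1 -leqNgt; apply; last exact: enum_uniq.
  apply/allP=> x; rewrite mem_enum => /allx; rewrite negbK => /eqP xj.
  by rewrite rootE !hornerE xj subrr.
have : x ^+ j.+1 * (\sum_(y : K) y ^+ j.+1) = \sum_(y : K) y ^+ j.+1.
  rewrite mulr_sumr [RHS](reindex_inj (mulfI x0)).
  by apply: eq_bigr => y _; rewrite exprMn.
move/eqP; rewrite -subr_eq0 -{2}[\sum_y _]mul1r -mulrBl mulf_eq0 subr_eq0.
by rewrite (negPf xj) => /eqP.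
Qed.

Lemma sum_expr_finField_gap (j : nat) :
  (#|K|.-1 < j < 2 * #|K|.-1)%N -> \sum_(x : K) x ^+ j = 0.
Proof.
case/andP=> jl ju; have K1 := finNzRing_gt1 K.
transitivity (\sum_(x : K) x ^+ (j - #|K|.-1)); last first.
  by rewrite sum_expr_finField_small //; lia.
apply: eq_bigr => x _.
have -> : j = (#|K| + (j - #|K|))%N by lia.
rewrite exprD expf_card -exprS; congr (_ ^+ _); lia.
Qed.

Lemma horner_sum_small (p : {poly K}) :
  (size p <= #|K|.-1)%N -> \sum_(x : K) p.[x] = 0.
Proof.
move=> sp; under eq_bigr do rewrite horner_coef.
rewrite exchange_big /= big1 // => i _.
by rewrite -mulr_sumr sum_expr_finField_small ?mulr0 // (leq_trans _ sp).
Qed.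

(** The total degree in two variables is encoded by the sizes of the coefficients; truncated
    subtraction kills those beyond [d]. *)
Lemma size_coefM_tdeg (F G : {poly {poly K}}) (d e : nat) :
    (forall i, size (F`_i)%R <= d.+1 - i)%N ->
    (forall i, size (G`_i)%R <= e.+1 - i)%N ->
  forall i, (size ((F * G)`_i)%R <= (d + e).+1 - i)%N.
Proof.
move=> sF sG i; rewrite coefM; apply: (leq_trans (size_sum _ _ _)).
apply/bigmax_leqP => j _; have ji := ltn_ord j.
have := sF j; have := sG (i - j)%N.
have [->|F0] := eqVneq F`_j 0; first by rewrite mul0r size_poly0.
have [->|G0] := eqVneq G`_(i - j) 0; first by rewrite mulr0 size_poly0.
rewrite size_mul //; move: F0 G0; rewrite -!size_poly_gt0.
have arith (a b : nat) : (0 < a -> 0 < b -> b <= e.+1 - (i - j) ->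
  a <= d.+1 - j -> (a + b).-1 <= (d + e).+1 - i)%N by lia.
exact: arith.
Qed.

(* The sum of the v-derivative of v F; the only monomial of F that could
   survive is (u v)^(q - 1), and its coefficient is multiplied by q = 0. *)
Lemma sum_deriv_bivariate (F : {poly {poly K}}) (d : nat) :
    (forall i, size (F`_i)%R <= d.+1 - i)%N -> (d < 3 * #|K|.-1)%N ->
  \sum_(u : K) \sum_(v : K)
    ('X * map_poly (horner_eval u) F)^`().[v] = 0.
Proof.
move=> sF dQ; have K1 := finNzRing_gt1 K.
have E u v : ('X * map_poly (horner_eval u) F)^`().[v]
   = \sum_(i < size F) (F`_i).[u] * (v ^+ i *+ i.+1).
  rewrite (@horner_coef_wide _ (size F)); last first.
    apply/leq_sizeP => j sj.
    by rewrite coef_deriv coefXM coef_map /= (nth_default _ sj) rmorph0 mul0rn.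
  apply: eq_bigr => i _; rewrite coef_deriv coefXM /= coef_map.
  by rewrite mulrnAl mulrnAr.
under eq_bigr do under eq_bigr do rewrite E.
under eq_bigr do rewrite exchange_big /=.
rewrite exchange_big big1 //= => i _.
under eq_bigr do rewrite -mulr_sumr.
rewrite -mulr_suml sumrMnl.
(* If the sum over [u] may survive, the coefficient of [v^i] has degree at least [#|K|.-1], so
   [i < 2 * #|K|.-1]. *)
have [si|si] := leqP (size F`_i) #|K|.-1.
  by rewrite horner_sum_small // mul0r.
have [il|il|il] := ltngtP i #|K|.-1.
- by rewrite sum_expr_finField_small // mul0rn mulr0.
- rewrite sum_expr_finField_gap ?mul0rn ?mulr0 // il /=.
  have arith (Q n : nat) : (d < 3 * Q -> Q < d.+1 - n -> n < 2 * Q)%N by lia.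
  by apply: arith dQ _; exact: leq_trans si (sF i).
rewrite il prednK ?(ltnW K1) //.
by rewrite -[_ *+ #|K|]mulr_natr natr_card_finField !mulr0.
Qed.

(* A Jamison-type bound for the lines c i = u * a i + v * b i of the affine
   plane over K: the product F of their equations vanishes, together with the
   v-derivative of v F, at every point other than the origin. *)
Lemma double_cover_bound (I : finType) (D : {set I}) (a b c : I -> K) :
    {in D, forall i, c i != 0} ->
    (forall u v : K, v != 0%R ->
      2 <= #|[set i in D | (c i == u * a i + v * b i)%R]|)%N ->
    (forall u : K, u != 0%R -> 0 < #|[set i in D | (c i == u * a i)%R]|)%N ->
  (3 * #|K|.-1 <= #|D|)%N.
Proof.
move=> c0 cov2 cov1; rewrite leqNgt; apply/negP => Dsmall.
(* The inner variable is [u], the outer one [v]. *)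
pose L i : {poly {poly K}} := ((c i)%:P - a i *: 'X)%:P - (b i)%:P *: 'X.
pose F := \prod_(i in D) L i.
have sF i : (size (F`_i)%R <= #|D|.+1 - i)%N.
  rewrite /F -sum1_card; elim/big_rec2: _ i => [|j d G _ IH] i.
    by rewrite coef1; case: i => [|i]; rewrite ?size_poly1 ?size_poly0.
  apply: size_coefM_tdeg => // {}i.
  rewrite coefB coefC coefZ coefX; case: i => [|[|i]] /=.
  - rewrite mulr0 subr0 (leq_trans (size_polyD _ _)) // size_polyN geq_max.
    rewrite size_polyC (leq_trans (leq_b1 _)) //.
    by rewrite (leq_trans (size_scale_leq _ _)) ?size_polyX.
  - by rewrite mulr1 sub0r size_polyN size_polyC leq_b1.
  - by rewrite mulr0 subr0 size_poly0.
have := sum_deriv_bivariate sF Dsmall.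
pose l u i : {poly K} := (c i - u * a i)%:P - b i *: 'X.
have mapF u : map_poly (horner_eval u) F = \prod_(i in D) l u i.
  rewrite rmorph_prod; apply: eq_bigr => i _.
  rewrite /L rmorphB /= map_polyZ map_polyC map_polyX /= /horner_eval.
  by rewrite !hornerE mulrC.
have hl u v i : (l u i).[v] = c i - u * a i - v * b i.
  by rewrite /l !hornerE; ring.
clearbody l.
have deg u v : v != 0 ->
    (\prod_(i in D) l u i).[v] = 0 /\ (\prod_(i in D) l u i)^`().[v] = 0.
  move=> v0; have /card_gt1P[i [j []]] := cov2 u v v0.
  rewrite !inE => /andP[iD /eqP ci] /andP[jD /eqP cj] ij.
  rewrite (bigD1 i) //= (bigD1 j) /=; last by rewrite jD eq_sym.
  have li0 : (l u i).[v] = 0 by rewrite hl ci; ring.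
  have lj0 : (l u j).[v] = 0 by rewrite hl cj; ring.
  by rewrite !derivM !(hornerM, hornerD) li0 lj0; split; ring.
have dG u v : ('X * map_poly (horner_eval u) F)^`().[v]
    = (\prod_(i in D) l u i).[v] + v * (\prod_(i in D) l u i)^`().[v].
  by rewrite mapF derivM derivX mul1r hornerD hornerM hornerX.
under eq_bigr do under eq_bigr do rewrite dG.
(* Only the origin contributes. On [v = 0] the derivative carries the factor [v], so one vanishing
   line suffices there. At the origin the value is the product of the nonzero [c i]. *)
rewrite (bigD1 0) //= (bigD1 0) //= mul0r addr0.
rewrite [X in _ + X + _]big1 => [|v v0]; last first.
  by have [-> ->] := deg 0 v v0; rewrite mulr0 addr0.
rewrite [X in _ + X]big1 => [|u u0]; last first.
  rewrite (bigD1 0) //= [X in _ + X]big1 => [|v v0]; last first.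
    by have [-> ->] := deg u v v0; rewrite mulr0 addr0.
  rewrite mul0r !addr0; have /card_gt0P[i] := cov1 u u0.
  rewrite !inE => /andP[iD /eqP ci].
  by rewrite (bigD1 i) //= hornerM hl ci mul0r subr0 subrr mul0r.
rewrite !addr0 horner_prod => /eqP/prodf_eq0[i iD].
by rewrite hl !mul0r !subr0 (negPf (c0 i iD)).
Qed.

End FiniteFieldSums.

(** * Moments of the number of zeros of a functional *)

(** As [B] has a right inverse, all fibers of multiplication by [B] are translates of the kernel. *)
Lemma card_mulmx_fiber (K : finFieldType) (d m : nat) (B : 'M[K]_(d, m)) :
  row_free B ->
  (#|[set A : 'cV[K]_m | B *m A == 0%R]| * #|K| ^ d)%N = (#|K| ^ m)%N.
Proof.
move=> Bfree.
have -> : (#|K| ^ m)%N = #|{: 'cV[K]_m}| by rewrite card_mx muln1.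
have -> : (#|K| ^ d)%N = #|{: 'cV[K]_d}| by rewrite card_mx muln1.
rewrite -[RHS]sum1_card (partition_big (mulmx B) predT) //=.
rewrite mulnC -sum_nat_const; apply: eq_bigr => w _.
rewrite -sum1_card (reindex_inj (addIr (- (pinvmx B *m w)))) /=.
apply: eq_bigl => A.
by rewrite inE mulmxBr mulmxA mulmxVp // mul1mx subr_eq0.
Qed.

Lemma card_bigcup_leq (I T : finType) (S : {set I}) (G : I -> {set T}) :
  (#|\bigcup_(i in S) G i| <= \sum_(i in S) #|G i|)%N.
Proof.
elim/big_rec2: _ => [|i n A _ IH]; first by rewrite cards0.
by rewrite (leq_trans (leq_card_setU _ _)) // leq_add2l.
Qed.

Section Functionals.

Variables (K : finFieldType) (m : nat) (X : finType) (r : X -> 'rV[K]_m).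
Hypothesis r_neq0 : forall x, r x != 0.
Hypothesis r_free : forall x y, x != y -> row_free (col_mx (r x) (r y)).

Local Notation Q := #|K|.
Local Notation functional := 'cV[K]_m.

(** The trace of a hyperplane on [X]; the zero functional is included and vanishes on all of [X]. *)
Definition zeros (A : functional) : {set X} := [set x | r x *m A == 0].

Lemma card_zero1 x : (#|[set A | x \in zeros A]| * Q)%N = (Q ^ m)%N.
Proof.
have := @card_mulmx_fiber K 1 m (r x); rewrite expn1 => <-.
  by congr (_ * _)%N; apply: eq_card => A; rewrite !inE.
by rewrite /row_free rank_rV r_neq0.
Qed.

Lemma card_zero2 x y : x != y ->
  (#|[set A | (x \in zeros A) && (y \in zeros A)]| * Q ^ 2)%N = (Q ^ m)%N.
Proof.
move=> /r_free/card_mulmx_fiber <-; congr (_ * _)%N.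
apply: eq_card => A; rewrite !inE mul_col_mx.
rewrite -[0 in RHS](@col_mx0 _ 1 1).
by apply/andP/eqP => [[/eqP-> /eqP->]|/eq_col_mx[-> ->]].
Qed.

Lemma sum_card_zeros (C : {set X}) :
  ((\sum_A #|C :&: zeros A|) * Q)%N = (#|C| * Q ^ m)%N.
Proof.
under eq_bigr do rewrite -sum1_card.
under eq_bigr do (under eq_bigl do rewrite inE; rewrite big_mkcondr).
rewrite exchange_big /= big_distrl /= -sum_nat_const.
by apply: eq_bigr => x _; rewrite -(card_zero1 x) -big_mkcond /= sum1dep_card.
Qed.

(** The partner set depends on [x] so that one count serves for ordered pairs within a class and for
    pairs across two classes. *)
Lemma sum_card_zeros_pairs (C : {set X}) (E : X -> {set X}) (e : nat) :
    {in C, forall x, x \notin E x} -> {in C, forall x, #|E x| = e} ->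
  ((\sum_A \sum_(x in C :&: zeros A) #|E x :&: zeros A|) * Q ^ 2
    = #|C| * e * Q ^ m)%N.
Proof.
move=> xE cE.
under eq_bigr do (under eq_bigl do rewrite inE; rewrite big_mkcondr).
rewrite exchange_big /= big_distrl /= -mulnA -sum_nat_const.
apply: eq_bigr => x xC; rewrite -(cE x xC) -sum_nat_const -big_mkcond /=.
under eq_bigr do rewrite -sum1_card.
under eq_bigr do (under eq_bigl do rewrite inE; rewrite big_mkcondr).
rewrite exchange_big /= big_distrl /=.
apply: eq_bigr => y yE; have xy : x != y by apply: contraNneq (xE x xC) => {1}->.
by rewrite -(card_zero2 xy) -big_mkcondr /= sum1dep_card.
Qed.

Lemma sum_card_zeros_ord (C : {set X}) :
  ((\sum_A #|C :&: zeros A| * (#|C :&: zeros A| - 1)) * Q ^ 2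
    = #|C| * (#|C| - 1) * Q ^ m)%N.
Proof.
rewrite -(@sum_card_zeros_pairs C (fun x => C :\ x)).
- congr (_ * _)%N; apply: eq_bigr => A _; rewrite -sum_nat_const.
  apply: eq_bigr => x xC; rewrite setIDAC.
  by have := cardsD1 x (C :&: zeros A); rewrite xC; lia.
- by move=> x _; rewrite !inE eqxx.
by move=> x xC; have := cardsD1 x C; rewrite xC; lia.
Qed.

Lemma sum_card_zeros_mul (C D : {set X}) : [disjoint C & D] ->
  ((\sum_A #|C :&: zeros A| * #|D :&: zeros A|) * Q ^ 2
    = #|C| * #|D| * Q ^ m)%N.
Proof.
move=> disCD; rewrite -(@sum_card_zeros_pairs C (fun=> D)) //.
  by congr (_ * _)%N; apply: eq_bigr => A _; rewrite -sum_nat_const.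
by move=> x xC; rewrite (disjointFr disCD).
Qed.

Definition blocked (C : {set X}) : {set functional} :=
  [set A | (1 < #|C :&: zeros A|)%N].

(** Markov's inequality for the number of zeros. *)
Lemma card_blocked_linear (C : {set X}) :
  (2 * #|blocked C| * Q <= #|C| * Q ^ m)%N.
Proof.
rewrite -sum_card_zeros leq_mul2r; apply/orP; right.
rewrite mulnC -sum_nat_const big_mkcond /=; apply: leq_sum => A _.
by rewrite inE; case: ltnP.
Qed.

(** Markov's inequality for the number of ordered pairs of distinct zeros. *)
Lemma card_blocked_quadratic (C : {set X}) :
  (2 * #|blocked C| * Q ^ 2 <= #|C| * (#|C| - 1) * Q ^ m)%N.
Proof.
rewrite -sum_card_zeros_ord leq_mul2r; apply/orP; right.
rewrite mulnC -sum_nat_const big_mkcond /=; apply: leq_sum => A _.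
by rewrite inE; case: ltnP => // h; nia.
Qed.

(** A union bound: a further point is a zero of a fraction [1/Q] of the functionals vanishing at
    [y]. *)
Lemma functional_avoiding (y : X) (S : {set X}) : y \notin S -> (#|S| < Q)%N ->
  exists2 A, y \in zeros A & [disjoint S & zeros A].
Proof.
move=> yS SQ; apply/exists_inP; apply: contraLR SQ => /exists_inPn noA.
have Q0 : (0 < Q)%N := ltnW (finNzRing_gt1 K).
have cover : [set A | y \in zeros A] \subset
    \bigcup_(x in S) [set A | (x \in zeros A) && (y \in zeros A)].
  apply/subsetP => A; rewrite inE => yA.
  have /pred0Pn[x /andP[/= xS xA]] := noA A yA.
  by apply/bigcupP; exists x; rewrite // inE xA.
rewrite -leqNgt.
have /(leq_trans (subset_leq_card cover)) := card_bigcup_leq S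
  (fun x => [set A | (x \in zeros A) && (y \in zeros A)]).
rewrite -(leq_pmul2r (_ : 0 < Q ^ 2)%N) ?expn_gt0 ?Q0 // big_distrl /=.
under eq_bigr => x xS.
  rewrite card_zero2; last by apply: contraNneq yS => <-.
  over.
rewrite sum_nat_const expnS expn1 mulnA card_zero1 mulnC.
by rewrite leq_pmul2r // expn_gt0 Q0.
Qed.

Lemma functional_separating (y z : X) : y != z ->
  exists2 A : functional, (r y *m A) 0 0 = 1 & z \in zeros A.
Proof.
move=> yz; have := mulmxVp (r_free yz).
set B := pinvmx _ => BV; exists (B *m col_mx 1%:M 0).
  have := congr1 (fun M => (usubmx (M *m col_mx 1%:M 0)) 0 0) BV.
  by rewrite -mulmxA mul_col_mx mul1mx !col_mxKu => ->; rewrite mxE.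
have := congr1 (fun M => dsubmx (M *m col_mx 1%:M (0 : 'cV_1))) BV.
by rewrite -mulmxA mul_col_mx mul1mx !col_mxKd => B0; rewrite inE B0.
Qed.

Lemma in_zeros A x : (x \in zeros A) = ((r x *m A) 0 0 == 0).
Proof.
rewrite inE; apply/eqP/eqP => [->|A0]; first by rewrite mxE.
by apply/matrixP => i j; rewrite !ord1 A0 mxE.
Qed.

(** * Tangent functionals and minimal double blocking sets *)

(** The pencil is spanned by [phi] and a [g] whose only common zero with [phi] in [T] is [y], so its
    members share no other point of [T]. The size of [S] comes from [double_cover_bound]. *)
Lemma tangent_pencil (M T : {set X}) (phi : functional) (y z : X) :
    (forall A, 1 < #|M :&: zeros A|)%N -> y != z ->
    M :&: zeros phi = [set y; z] -> M \subset T -> (#|T :\: M| + 1 < Q)%N ->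
  exists (S : {set K}) (W : K -> functional),
    [/\ (3 * Q <= #|M| + #|S| + 1)%N,
        forall v, v \in S -> y \in zeros (W v) /\ #|M :&: zeros (W v)| = 2
      & forall v w x, x \in T -> x != y ->
          x \in zeros (W v) -> x \in zeros (W w) -> v = w].
Proof.
move=> M2 yz Mphi MT TMQ.
have [yM yphi] : y \in M /\ y \in zeros phi.
  by apply/setIP; rewrite Mphi !inE eqxx.
have [zM zphi] : z \in M /\ z \in zeros phi.
  by apply/setIP; rewrite Mphi !inE eqxx orbT.
have [g yg gT] : exists2 g, y \in zeros g &
    [disjoint (T :&: zeros phi) :\ y & zeros g].
  apply: functional_avoiding => //; first by rewrite !inE eqxx.
  (* The points to avoid are [z] or lie in [T :\: M]. *)
  apply: leq_ltn_trans TMQ; rewrite -(cards1 z).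
  apply: leq_trans (leq_card_setU _ _); apply: subset_leq_card.
  apply/subsetP => x /setD1P[xy /setIP[xT xphi]].
  rewrite in_setU in_setD xT andbT; case xM: (x \in M) => //=.
  have : x \in M :&: zeros phi by rewrite in_setI xM.
  by rewrite Mphi !inE (negPf xy).
have [f fy zf] := functional_separating yz.
pose e A x := (r x *m A : 'M_1) 0 0.
have eP A x : (x \in zeros A) = (e A x == 0) by rewrite in_zeros.
have eL u v x : e (phi - u *: f - v *: g) x = e phi x - u * e f x - v * e g x.
  by rewrite /e !mulmxBr -!scalemxAr !mxE.
(* The functionals W2 u v form an affine plane, in which the functionals that
   vanish at a point outside the zeros of phi form a line avoiding the origin
   phi.  W2 u v vanishes at y only if u = 0 and at z only if v = 0, and S
   collects the values v whose W2 0 v is short of one zero outside y. *)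
pose W v := phi - v *: g; pose W2 u v := phi - u *: f - v *: g.
have W0 v : W2 0 v = W v by rewrite /W2 scale0r subr0.
pose S := [set v | (v != 0) && (#|M :&: zeros (W v)| == 2%N)].
have eW v x : e (W v) x = e phi x - v * e g x.
  by rewrite -W0 eL mul0r subr0.
have gne x : x \in T -> x != y -> x \in zeros phi -> e g x != 0.
  move=> xT xy xphi; rewrite -eP (disjointFr gT) //.
  by rewrite !inE xy xT; rewrite inE in xphi.
exists S, W; split; last 2 first.
- move=> v; rewrite inE => /andP[_ /eqP]; split=> //.
  by move: yphi yg; rewrite !eP eW => /eqP -> /eqP ->; rewrite mulr0 subrr.
- move=> v w x xT xy; rewrite !eP !eW => /eqP xv /eqP xw.
  have [xg|xg] := eqVneq (e g x) 0.
    move: xv; rewrite xg mulr0 subr0 => xv.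
    by have := gne x xT xy; rewrite eP xv xg eqxx => /(_ isT).
  apply: (mulIf xg); apply/eqP; rewrite -subr_eq0.
  have -> : v * e g x - w * e g x =
    (e phi x - w * e g x) - (e phi x - v * e g x) by ring.
  by rewrite xv xw subrr.
pose M0 := M :\: zeros phi.
have cM0 : #|M| = (#|M0| + 2)%N.
  by rewrite -(cardsID (zeros phi) M) Mphi cards2 yz addnC.
(* Besides the lines of the points of [M0], each [w] in [S] adds the line [v = w], which supplies
   the missing second cover on the axis [u = 0]. *)
pose D := [set i : X + K | match i with inl x => x \in M0 | inr v => v \in S end].
have cD : (#|D| <= #|M0| + #|S|)%N.
  rewrite -(card_imset _ (@inl_inj X K)) -(card_imset (mem S) (@inr_inj X K)).
  apply: leq_trans (leq_card_setU _ _); apply: subset_leq_card.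
  by apply/subsetP => -[x|v]; rewrite inE => iD; rewrite inE imset_f ?orbT.
pose a (i : X + K) : K := match i with inl x => e f x | inr _ => 0 end.
pose b (i : X + K) : K := match i with inl x => e g x | inr _ => 1 end.
pose c (i : X + K) : K := match i with inl x => e phi x | inr v => v end.
pose Cov (u v : K) := [set i in D | c i == u * a i + v * b i].
have covE (u v : K) (V : {set K}) : V \subset S -> V \subset [set v] ->
    (#|M0 :&: zeros (W2 u v)| + #|V| <= #|Cov u v|)%N.
  move=> VS Vv; rewrite -(card_imset _ (@inl_inj X K)).
  rewrite -(card_imset (mem V) (@inr_inj X K)) -cardsUI.
  rewrite [X in (_ + X)%N](_ : _ = 0%N) ?addn0; last first.
    apply/eqP; rewrite cards_eq0 -subset0; apply/subsetP => i.
    by case/setIP => /imsetP[x _ ->] /imsetP[].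
  apply: subset_leq_card; apply/subsetP => i; rewrite in_setU !in_set => /orP[].
    case/imsetP => x; rewrite in_setI => /andP[xM0]; rewrite eP eL => xW -> /=.
    by rewrite xM0 /= -subr_eq0 opprD addrA.
  case/imsetP => w wV -> /=; rewrite (subsetP VS) //= mulr0 add0r mulr1.
  by have := subsetP Vv w wV; rewrite inE.
have M0P A x : x \in M :&: zeros A -> [|| x == y, x == z | x \in M0 :&: zeros A].
  case/setIP => xM xA; rewrite !(in_setI, in_setD) xM xA !andbT.
  case xphi: (x \in zeros phi); rewrite ?orbT //=.
  have : x \in M :&: zeros phi by rewrite in_setI xM.
  by rewrite Mphi !inE orbF.
have ey u v : e (W2 u v) y = - u.
  move: yphi yg; rewrite !eP eL => /eqP -> /eqP ->.
  by rewrite mulr0 subr0 sub0r [e f y]fy mulr1.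
have ez u v : e (W2 u v) z = - (v * e g z).
  move: zphi zf; rewrite !eP eL => /eqP -> /eqP ->.
  by rewrite mulr0 subr0 sub0r.
have gz : e g z != 0 by apply: gne; rewrite ?(subsetP MT) // eq_sym.
suff : (3 * Q.-1 <= #|D|)%N.
  move=> /leq_trans/(_ cD); rewrite cM0.
  have arith (q n k : nat) : (1 < q -> 3 * q.-1 <= n + k -> 3 * q <= n + 2 + k + 1)%N.
    by clear; lia.
  exact: arith (finNzRing_gt1 K).
apply: (@double_cover_bound _ _ D a b c).
- move=> [x|v]; rewrite inE /=; last by rewrite inE => /andP[].
  by rewrite in_setD eP => /andP[].
- move=> u v v0; have zW : z \notin zeros (W2 u v).
    by rewrite eP ez oppr_eq0 mulf_neq0.
  have [u0|u0] := eqVneq u 0; last first.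
    rewrite (leq_trans _ (covE u v set0 _ _)) ?sub0set // cards0 addn0.
    rewrite (leq_trans (M2 (W2 u v))) // subset_leq_card //.
    apply/subsetP => x xMW; have := M0P _ _ xMW; have [_ xW] := setIP xMW.
    case/or3P => // /eqP xE; move: xW; rewrite xE eP.
      by rewrite ey oppr_eq0 (negPf u0).
    by rewrite ez oppr_eq0 mulf_eq0 (negPf v0) (negPf gz).
  have Msub : M :&: zeros (W2 u v) \subset y |: (M0 :&: zeros (W2 u v)).
    apply/subsetP => x xMW; have := M0P _ _ xMW; have [_ xW] := setIP xMW.
    rewrite in_setU1 => /or3P[-> //|/eqP xE|->]; last by rewrite orbT.
    by move: xW; rewrite xE (negPf zW).
  have := subset_leq_card Msub; rewrite cardsU1 in_setI in_setD yphi add1n.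
  have := M2 (W2 u v).
  case vS: (v \in S).
    have := covE u v [set v]; rewrite !sub1set set11 vS cards1 => /(_ isT isT).
    have arith (p q n : nat) : (p + 1 <= n -> 1 < q -> q <= 1 + p -> 1 < n)%N.
      by clear; lia.
    exact: arith.
  move: vS; rewrite inE v0 -W0 -u0 /=.
  have := covE u v set0; rewrite !sub0set cards0 => /(_ isT isT).
  have arith (p q n : nat) :
    (p + 0 <= n -> (q == 2) = false -> 1 < q -> q <= 1 + p -> 1 < n)%N by clear; lia.
  exact: arith.
(* On the axis [v = 0] the point [z] is a zero and [y] is not, so [M0] contains a further zero. *)
move=> u u0.
have yW : y \notin zeros (W2 u 0) by rewrite eP ey oppr_eq0.
have Msub : M :&: zeros (W2 u 0) \subset z |: (M0 :&: zeros (W2 u 0)).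
  apply/subsetP => x xMW; have := M0P _ _ xMW; have [_ xW] := setIP xMW.
  rewrite in_setU1 => /or3P[/eqP xE|-> //|->]; last by rewrite orbT.
  by move: xW; rewrite xE (negPf yW).
have := subset_leq_card Msub; rewrite cardsU1 in_setI in_setD zphi add1n.
have := M2 (W2 u 0); have := covE u 0 set0; rewrite !sub0set cards0 => /(_ isT isT).
have -> : Cov u 0 = [set i in D | c i == u * a i].
  by apply/setP => i; rewrite !in_set mul0r addr0.
have arith (p q n : nat) : (p + 0 <= n -> 1 < q -> q <= 1 + p -> 0 < n)%N.
  by clear; lia.
exact: arith.
Qed.

Lemma card_functional : #|{: functional}| = (Q ^ m)%N.
Proof. by rewrite card_mx muln1. Qed.

(** The average number of zeros in [M] is [#|M| / Q]. *)
Lemma card_double_blocking (M : {set X}) :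
  (forall A, 1 < #|M :&: zeros A|)%N -> (2 * Q <= #|M|)%N.
Proof.
move=> M2; have Q0 : (0 < Q)%N := ltnW (finNzRing_gt1 K).
rewrite -(leq_pmul2r (_ : 0 < Q ^ m)%N) ?expn_gt0 ?Q0 //.
rewrite -(sum_card_zeros) mulnAC leq_mul2r; apply/orP; right.
rewrite -card_functional mulnC -sum_nat_const.
by apply: leq_sum => A _; apply: M2.
Qed.

(** If a minimal [M] contained [y] outside [C], the members of the pencil indexed by [S] would have
    distinct zeros in [E0]. Then [3Q <= #|M| + #|E0| + 1 <= #|M| + #|C :\: M| + #|Y| <= #|C| + 2 *
    #|Y|]. *)
Lemma double_blocking_part (C Y : {set X}) :
    [disjoint C & Y] ->
    (forall A, (1 < #|C :&: zeros A|) || (1 < #|Y :&: zeros A|))%N ->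
    (#|C| + 2 * #|Y| < 3 * Q)%N ->
  forall A, (1 < #|C :&: zeros A|)%N.
Proof.
move=> disCY CY2 small.
pose blocking (M : {set X}) := [forall A, (1 < #|M :&: zeros A|)%N].
have : blocking (C :|: Y).
  apply/forallP => A; case/orP: (CY2 A) => /leq_trans-> //.
    by rewrite subset_leq_card // setSI // subsetUl.
  by rewrite subset_leq_card // setSI // subsetUr.
case/minset_exists => M /minsetP[/forallP M2 Mmin] MT.
suff MC : M \subset C.
  by move=> A; rewrite (leq_trans (M2 A)) // subset_leq_card // setSI.
apply/subsetP => y yM; apply: contraTT small => yC.
have yY : y \in Y by have := subsetP MT y yM; rewrite inE (negPf yC).
(* Minimality provides a functional with exactly two zeros in [M], one of them [y]. *)
have : ~~ blocking (M :\ y).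
  apply: contraL yM => /Mmin/(_ (subsetDl _ _)) <-.
  by rewrite !inE eqxx.
case/forallPn => phi; rewrite -leqNgt => phi1.
have := cardsD1 y (M :&: zeros phi); rewrite setIDAC in phi1.
have := M2 phi; case yphi: (y \in M :&: zeros phi); last by move=> + E; lia.
move=> gt1 E; have /eqP/cards1P[z zE] : #|(M :&: zeros phi) :\ y| = 1%N by lia.
have yz : y != z.
  by have := set11 z; rewrite -zE !inE eq_sym => /andP[].
have Mphi : M :&: zeros phi = [set y; z] by rewrite -(setD1K yphi) zE.
have cT : #|C :|: Y| = (#|C| + #|Y|)%N.
  by rewrite -cardsUI (disjoint_setI0 disCY) cards0 addn0.
have Y0 : (0 < #|Y|)%N by apply/card_gt0P; exists y.
(* If too many points lie outside [M], then [#|M| >= 2Q] gives [#|C| + #|Y| >= 3Q - 1] already, and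
   [Y] is nonempty. *)
rewrite -leqNgt; have [TM|TM] := leqP Q (#|(C :|: Y) :\: M| + 1).
  have := card_double_blocking M2; have := cardsID M (C :|: Y).
  by rewrite (setIidPr MT) cT; lia.
have [S [W [cS yS Winj]]] := tangent_pencil M2 yz Mphi MT TM.
pose E0 := (C :\: M) :|: (Y :\ y).
have cE0 : (#|E0| + 1 <= #|C :\: M| + #|Y|)%N.
  have := cardsD1 y Y; rewrite yY; have [+ _] := leq_card_setU (C :\: M) (Y :\ y).
  rewrite -/E0; lia.
have cMC : (#|M| + #|C :\: M| <= #|C| + #|Y|)%N.
  rewrite -cT -cardsUI [M :&: _](_ : _ = set0) ?cards0 ?addn0.
    rewrite subset_leq_card // subUset MT (subset_trans (subsetDl _ _)) //.
    exact: subsetUl.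
  by apply/setP => x; rewrite !inE; case: (x \in M).
have E0T x : x \in E0 -> x \in C :|: Y /\ x != y.
  rewrite !inE => /orP[/andP[_ xC]|/andP[xy xY]]; rewrite ?xC ?xY ?orbT //.
  by split=> //; apply: contraNneq yC => <-.
(* Two zeros in [Y] include one other than [y]. Two zeros in [C] cannot both lie in [M], where one
   of the only two zeros is [y], outside [C]. *)
have hitE v : v \in S -> [exists x in E0, x \in zeros (W v)].
  case/yS => yW cMW; apply/exists_inP.
  case/orP: (CY2 (W v)) => [C2|/card_gt1P[x1 [x2 []]]]; last first.
    rewrite !in_setI => /andP[x1Y x1W] /andP[x2Y x2W] x12.
    have [x1y|x1y] := eqVneq x1 y.
      by exists x2; rewrite // in_setU in_setD1 x2Y -x1y eq_sym x12 orbT.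
    by exists x1; rewrite // in_setU in_setD1 x1Y x1y orbT.
  case/boolP: (C :&: zeros (W v) \subset (M :&: zeros (W v)) :\ y) => [sub|].
    have := subset_leq_card sub; have := cardsD1 y (M :&: zeros (W v)).
    by rewrite in_setI yM yW cMW; lia.
  case/subsetPn => x; rewrite in_setI => /andP[xC xW].
  rewrite in_setD1 in_setI xW andbT negb_and negbK => xE.
  exists x => //; rewrite in_setU in_setD xC andbT.
  by case/orP: xE => [/eqP xy|->] //; rewrite -xy xC in yC.
(* The default [y] is never taken for [v] in [S]. *)
pose pt v := odflt y [pick x in E0 | x \in zeros (W v)].
have ptP v : v \in S -> pt v \in E0 /\ pt v \in zeros (W v).
  move=> /hitE/exists_inP[x xE xW]; rewrite /pt.
  by case: pickP => [x' /andP[]|/(_ x)] //=; rewrite xE xW.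
have cSE : (#|S| <= #|E0|)%N.
  rewrite -(card_in_imset (f := pt)) => [|v w vS wS pvw].
    rewrite subset_leq_card //; apply/subsetP => _ /imsetP[v vS ->].
    by have [] := ptP v vS.
  have [pE pv] := ptP v vS; have [_ pw] := ptP w wS; have [pT py] := E0T _ pE.
  by apply: (Winj v w (pt v)) => //; rewrite pvw.
lia.
Qed.

(** * Color classes that block every functional *)

(** This sums [count_pair_cover] over all functionals, with [B] the exceptional ones. *)
Lemma two_class_count (C D : {set X}) (B : {set functional}) (R : nat) :
    [disjoint C & D] ->
    (forall A, [|| A \in B, A \in blocked C | A \in blocked D]) ->
    (2 * #|B| * Q ^ 2 <= R * Q ^ m)%N ->
  (12 * Q ^ 2 + #|C| * #|D| <= 4 * (#|C| * (#|C| - 1)) + 4 * (#|D| * (#|D| - 1))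
     + 2 * Q * (#|C| + #|D|) + 6 * R)%N.
Proof.
move=> disCD cov BR; have Q0 : (0 < Q)%N := ltnW (finNzRing_gt1 K).
have Qm0 : (0 < Q ^ m)%N by rewrite expn_gt0 Q0.
have pointwise A : (12 + #|C :&: zeros A| * #|D :&: zeros A| <=
   4 * (#|C :&: zeros A| * (#|C :&: zeros A| - 1))
   + 4 * (#|D :&: zeros A| * (#|D :&: zeros A| - 1))
   + 2 * #|C :&: zeros A| + 2 * #|D :&: zeros A| + 12 * (A \in B))%N.
  have := cov A; rewrite [A \in blocked C]inE [A \in blocked D]inE.
  exact: count_pair_cover.
have : (\sum_A (12 + #|C :&: zeros A| * #|D :&: zeros A|) <= \sum_A (
   4 * (#|C :&: zeros A| * (#|C :&: zeros A| - 1))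
   + 4 * (#|D :&: zeros A| * (#|D :&: zeros A| - 1))
   + 2 * #|C :&: zeros A| + 2 * #|D :&: zeros A| + 12 * (A \in B)))%N.
  by apply: leq_sum => A _; apply: pointwise.
have sumM (k4 k2 k12 : nat) (a b c d e : functional -> nat) :
    (\sum_A (k4 * a A + k4 * b A + k2 * c A + k2 * d A + k12 * e A) =
     k4 * (\sum_A a A) + k4 * (\sum_A b A) + k2 * (\sum_A c A)
     + k2 * (\sum_A d A) + k12 * (\sum_A e A))%N.
  by rewrite !big_split /= !big_distrr.
rewrite sumM big_split /= sum_nat_const card_functional.
have -> : (\sum_(A : functional) (A \in B) = #|B|)%N.
  by rewrite -sum1_card [RHS]big_mkcond; apply: eq_bigr => A _; case: (A \in B).
apply: weighted_count_arith BR Qm0 Q0 _ _ _ _ _.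
- exact: sum_card_zeros.
- exact: sum_card_zeros.
- exact: sum_card_zeros_mul.
- exact: sum_card_zeros_ord.
exact: sum_card_zeros_ord.
Qed.

Lemma card_blocked_family (P : {set {set X}}) (s : nat) :
    {in P, forall C : {set X}, #|C| <= s}%N ->
  (2 * (\sum_(C in P) #|blocked C|) * Q ^ 2
    <= s * (\sum_(C in P) (#|C| - 1)) * Q ^ m)%N.
Proof.
move=> sP; rewrite !big_distrr !big_distrl /=; apply: leq_sum => C /sP Cs.
rewrite (leq_trans (card_blocked_quadratic C)) //.
by rewrite leq_mul2r leq_mul2r Cs !orbT.
Qed.

Theorem functional_coloring (P : {set {set X}}) :
    trivIset P -> (forall A, exists2 C, C \in P & 1 < #|C :&: zeros A|)%N ->
    (100 * (\sum_(C in P) (#|C| - 1)) + 200 <= 202 * Q)%N ->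
  exists2 C, C \in P & forall A, (1 < #|C :&: zeros A|)%N.
Proof.
move=> /trivIsetP Ptriv cov dQ; have Q0 : (0 < Q)%N := ltnW (finNzRing_gt1 K).
have Qm0 : (0 < Q ^ m)%N by rewrite expn_gt0 Q0.
have covP : (Q ^ m <= \sum_(C in P) #|blocked C|)%N.
  rewrite -card_functional (leq_trans _ (card_bigcup_leq _ _)) //.
  rewrite subset_leq_card //; apply/subsetP => A _.
  by have [C CP CA] := cov A; apply/bigcupP; exists C => //; rewrite inE.
have [C0 C0P _] := cov 0.
case: (arg_maxnP (fun C : {set X} => #|C|) C0P) => C1 C1P C1max.
set d := (\sum_(C in P) _)%N in dQ.
pose r1 := (\sum_(C in P :\ C1) (#|C| - 1))%N.
have dE : d = (#|C1| - 1 + r1)%N by rewrite /d (big_setD1 C1).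
have C1d : (2 * Q ^ 2 <= #|C1| * d)%N.
  rewrite -(leq_pmul2r Qm0) (leq_trans _ (card_blocked_family C1max)) //.
  by rewrite mulnAC leq_mul2r leq_mul2l covP !orbT.
have C1Q := largest_class_arith Q0 dQ C1d.
have [r1Q|r1Q] := leqP (10 * r1) (3 * Q).
  (* A class with at least two points has at most twice its excess in points; singletons block
     nothing. *)
  pose P2 := [set C in P :\ C1 | (1 < #|C|)%N].
  have cY : (#|cover P2| <= 2 * r1)%N.
    rewrite (leq_trans (leq_card_cover P2)) // /r1 big_distrr /=.
    rewrite big_mkcond [leqRHS]big_mkcond /=; apply: leq_sum => C _.
    by rewrite inE; case: (C \in P :\ C1) => //=; case: ltnP => //; lia.
  exists C1 => //; apply: (@double_blocking_part _ (cover P2)).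
  - rewrite -setI_eq0; apply/eqP/setP => x; rewrite !inE; apply/negP.
    case/andP => xC1 /bigcupP[C]; rewrite !inE => /andP[/andP[CC1 CP] _] xC.
    have C1C : C1 != C by rewrite eq_sym.
    by rewrite (disjointFr (Ptriv _ _ C1P CP C1C) xC1) in xC.
  - move=> A; have [C CP CA] := cov A.
    have [<-|CC1] := eqVneq C C1; first by rewrite CA.
    apply/orP; right; rewrite (leq_trans CA) // subset_leq_card // setSI //.
    apply/subsetP => x xC; apply/bigcupP; exists C => //; rewrite !inE CC1 CP.
    by rewrite (leq_trans CA) // subset_leq_card // subsetIl.
  exact: dominant_class_arith dQ dE cY r1Q.
have [C2 C2P C2max] : exists2 C2, C2 \in P :\ C1 &
    {in P :\ C1, forall C : {set X}, (#|C| <= #|C2|)%N}.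
  have [Pe|[C3 C3P]] := set_0Vmem (P :\ C1).
    by rewrite /r1 Pe big_set0 in r1Q.
  by case: (arg_maxnP (fun C : {set X} => #|C|) C3P) => C2; exists C2.
pose r2 := (\sum_(C in P :\ C1 :\ C2) (#|C| - 1))%N.
have r1E : r1 = (#|C2| - 1 + r2)%N by rewrite /r1 (big_setD1 C2).
(* [C1] is counted by the linear bound, all other classes by the quadratic bound with maximal size
   [#|C2|]. *)
have C2r : (2 * Q ^ 2 <= #|C1| * Q + #|C2| * r1)%N.
  apply: linear_count_arith Q0 Qm0 (card_blocked_linear C1)
    (card_blocked_family C2max) _.
  by rewrite -(big_setD1 C1).
have C2Q := second_class_arith Q0 dQ dE r1Q C2r.
pose B := \bigcup_(C in P :\ C1 :\ C2) blocked C.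
(* The excess of each remaining class is at most [r2], hence its size at most [r2 + 1]. *)
have cB : (2 * #|B| * Q ^ 2 <= (r2 + 1) * r2 * Q ^ m)%N.
  apply: leq_trans (card_blocked_family (s := r2 + 1) _).
    by rewrite leq_mul2r leq_mul2l card_bigcup_leq !orbT.
  by move=> C CP; rewrite /r2 (big_setD1 C CP) /=; lia.
have /andP[C21 C2inP] : (C2 != C1) && (C2 \in P) by rewrite -in_setD1.
have disC : [disjoint C1 & C2] by apply: Ptriv => //; rewrite eq_sym.
have := two_class_count disC _ cB.
rewrite leqNgt (two_class_arith dQ dE r1E C1Q C2Q) => /(_ _)/negP[] // A.
have [C CP CA] := cov A; have bA : A \in blocked C by rewrite inE.
have [<-|CC1] := eqVneq C C1; first by rewrite bA orbT.
have [<-|CC2] := eqVneq C C2; first by rewrite bA !orbT.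
by apply/orP; left; apply/bigcupP; exists C; rewrite // !inE CC2 CC1.
Qed.

End Functionals.

(** * The extension field and its coordinates over the base field *)

(** The splitting field of [X^Q - X] works: its roots are distinct, the derivative being -1, and
    form the fixed field of a power of Frobenius, hence all of [L]. *)
Lemma finField_extension_of_degree (F : finFieldType) (k : nat) : (0 < k)%N ->
  exists L : fieldExtType F, #|finvect_type L| = (#|F| ^ k)%N.
Proof.
move=> k0; have F1 := finNzRing_gt1 F; set Q := (#|F| ^ k)%N.
have Q1 : (1 < Q)%N by rewrite (ltn_exp2l 0).
pose f (R : nzRingType) : {poly R} := 'X^Q - 'X.
have sf (R : nzRingType) : size (f R) = Q.+1.
  by rewrite size_polyDl size_polyXn // size_polyN size_polyX.
have /FinSplittingFieldFor[L] : f F != 0 by rewrite -size_poly_eq0 sf.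
have -> : map_poly (in_alg L) (f F) = f L by rewrite rmorphB /= map_polyXn map_polyX.
case=> zs fzs zsL; exists L.
have QL : Q%:R = 0 :> L.
  have := natr_card_finField F => /(congr1 (in_alg L)).
  by rewrite rmorph_nat rmorph0 natrX => ->; rewrite expr0n gtn_eqF.
have zsP z : (z \in zs) = (z ^+ Q == z).
  by rewrite -root_prod_XsubC -(eqp_root fzs) rootE !hornerE subr_eq0.
have zs_uniq : uniq zs.
  rewrite -separable_prod_XsubC -(eqp_separable fzs) separable_poly.unlock.
  rewrite derivB derivXn derivX -scaler_nat QL scale0r sub0r.
  by rewrite -scaleN1r coprimepZr ?oppr_eq0 ?oner_eq0 // coprimep1.
have /finField_galois_generator[/= a _ aE] : (1 <= {:L})%VS by apply: sub1v.
have aQ z : (a ^+ k)%g z = z ^+ Q.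
  rewrite /Q; elim: (k) => [|i IH]; first by rewrite expn0 gal_id.
  by rewrite expgSr galM ?memvf // IH aE ?memvf // dimv1 expn1 -exprM -expnSr.
pose E := fixedSpace (a ^+ k)%g.
have zsE : zs =i E.
  by move=> z; rewrite zsP -aQ (sameP fixedSpaceP eqP).
have ET : E = {:L}%VS.
  apply/eqP; rewrite eqEsubv subvf -zsL -[E]subfield_closed agenvS //.
  by rewrite subv_add sub1v; apply/span_subvP => z; rewrite zsE.
have /eq_card-> : finvect_type L =i zs by move=> z; rewrite zsE ET memvf.
apply: succn_inj; rewrite (card_uniqP _) //= -(size_prod_XsubC _ id).
by rewrite -(eqp_size fzs) sf.
Qed.

(** The column [b] lists a basis of the extension. *)
Lemma finField_extension_coordinates (F : finFieldType) (k : nat) : (0 < k)%N ->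
  exists (K : finFieldType) (iota : {rmorphism F -> K}) (b : 'cV[K]_k),
    #|K| = (#|F| ^ k)%N /\ forall c : 'rV[F]_k, map_mx iota c *m b = 0 -> c = 0.
Proof.
move=> /(finField_extension_of_degree F)[L cL].
have dimL : \dim {: finvect_type L} = k.
  apply: (expnI (finNzRing_gt1 F)); rewrite -cL dimvf -[X in (_ ^ X)%N]mul1n -card_mx.
  apply: esym; apply: bij_eq_card (Bijective _ _).
  - exact: VectorInternalTheory.v2rK.
  exact: VectorInternalTheory.r2vK.
exists (finvect_type L), (in_alg (finvect_type L)).
have [e eE] : exists e : k.-tuple (finvect_type L), basis_of {: finvect_type L} e.
  by rewrite -dimL; exists (vbasis _); apply: vbasisP.
exists (\col_i e`_i); split=> // c /matrixP/(_ 0 0); rewrite !mxE => c0.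
apply/rowP => j; rewrite mxE.
have /freeP := basis_free eE; apply.
by rewrite -[RHS]c0; apply: eq_bigr => i _; rewrite !mxE mulr_algl.
Qed.

(** * Projective subspaces and systems of [k] linear equations *)

(** The equations may be dependent, so the kernel may be too large; part of a basis of it spans
    [U]. *)
Lemma kernel_contains_pg_subspace (F : finFieldType) (n k : nat)
    (B : 'M[F]_(n.+1, k)) : (k <= n)%N ->
  exists2 U : {vspace 'rV[F]_n.+1}, pg_subspace (n - k) U &
    {in U, forall v, v *m B = 0}.
Proof.
move=> kn; pose f : 'Hom('rV[F]_n.+1, 'rV[F]_k) := linfun (mulmxr B).
pose ker := lker f.
have dker : ((n - k).+1 <= \dim ker)%N.
  have := limg_ker_dim f fullv.
  rewrite capfv -/ker dimvf /dim /= mul1n.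
  have : (\dim (limg f) <= k)%N.
    by rewrite (leq_trans (dimvS (subvf _))) // dimvf /dim /= mul1n.
  move: (\dim ker) (\dim _) => a b; clear -kn; lia.
pose e := take (n - k).+1 (vbasis ker).
have se : size e = (n - k).+1 by rewrite size_takel // size_tuple.
have fe : free e.
  have := basis_free (vbasisP ker).
  by rewrite -(cat_take_drop (n - k).+1 (vbasis ker)) => /catl_free.
exists <<e>>%VS; first by rewrite /pg_subspace (eqP fe) se.
move=> v ve; have : v \in ker.
  by apply: (subvP _ v ve); apply/span_subvP => w /mem_take/vbasis_mem.
by rewrite memv_ker lfunE /= => /eqP.
Qed.

(** The equations are the coordinates of the projection along [U] onto a complement, of dimension
    [k]. *)
Lemma pg_subspace_kernel (F : finFieldType) (n k : nat)
    (U : {vspace 'rV[F]_n.+1}) : (k <= n)%N -> pg_subspace (n - k) U ->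
  exists B : 'M[F]_(n.+1, k), forall v, v *m B = 0 -> v \in U.
Proof.
move=> kn /eqP dU; pose W := (U^C)%VS.
have dW : \dim W = k.
  by rewrite dimv_compl dU dimvf /dim /= mul1n; lia.
have [e eW] : exists e : k.-tuple 'rV[F]_n.+1, basis_of W e.
  by rewrite -dW; exists (vbasis _); apply: vbasisP.
have disWU : (W :&: U = 0)%VS by rewrite capvC capv_compl.
pose pi := daddv_pi W U.
exists (\matrix_(i, j) coord e j (pi (delta_mx 0 i))) => v v0.
have piv : pi v = 0.
  rewrite (coord_basis eW (memv_pi _ _ _)) big1 // => j _.
  have /rowP/(_ j) := v0; rewrite !mxE => vj.
  suff -> : coord e j (pi v) = 0 by rewrite scale0r.
  rewrite [X in pi X]row_sum_delta !linear_sum -[RHS]vj; apply: eq_bigr => i _.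
  by rewrite !linearZ mxE.
by rewrite -(daddv_pi_add disWU (_ : v \in W + U)%VS) ?piv ?add0r ?memv_pi //
  addvC addv_complf memvf.
Qed.

(** * Representatives and number of the projective points *)

Section PointVectors.

Variables (F : finFieldType) (n : nat).

Definition point_vector (x : pg_point F n) : 'rV[F]_n.+1 := vpick (val x).

Lemma dim_point (x : pg_point F n) : \dim (val x) = 1.
Proof. by have /eqP := valP x. Qed.

Lemma point_vector_neq0 x : point_vector x != 0.
Proof. by rewrite vpick0 -dimv_eq0 dim_point. Qed.

Lemma point_vectorE x : val x = <[point_vector x]>%VS.
Proof.
apply/eqP; rewrite eq_sym eqEdim -memvE memv_pick dim_point.
by rewrite dim_vline point_vector_neq0.
Qed.

Lemma mem_pg_points (U : {vspace 'rV[F]_n.+1}) x :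
  (x \in pg_points U) = (point_vector x \in U).
Proof. by rewrite inE point_vectorE -memvE. Qed.

Lemma point_eq x y : point_vector x \in <[point_vector y]>%VS -> x = y.
Proof.
rewrite memvE -!point_vectorE => xy; apply/val_inj/eqP.
by rewrite eqEdim xy !dim_point.
Qed.

Lemma point_vector_free x y : x != y ->
  row_free (col_mx (point_vector x) (point_vector y)).
Proof.
move=> xy; apply: inj_row_free => v.
rewrite -[v]hsubmxK mul_row_col [lsubmx v]mx11_scalar [rsubmx v]mx11_scalar.
rewrite !mul_scalar_mx; move: (lsubmx v 0 0) (rsubmx v 0 0) => a b ab.
have dep (c d : F) (z w : pg_point F n) : c != 0 ->
    c *: point_vector z + d *: point_vector w = 0 -> z = w.
  move=> c0 cd; apply: point_eq; apply/vlineP; exists (- (c^-1 * d)).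
  apply: (scalerI c0); rewrite scalerA mulrN mulrA divff // mul1r scaleNr.
  by apply/eqP; rewrite -addr_eq0 cd.
have [a0|/dep/(_ ab) xyE] := eqVneq a 0; last by rewrite xyE eqxx in xy.
have [b0|/dep] := eqVneq b 0; last first.
  by move=> /(_ a y x); rewrite addrC => /(_ ab) xyE; rewrite xyE eqxx in xy.
by rewrite a0 b0 -[LHS]/(row_mx _ _) !raddf0 row_mx0.
Qed.

(** Nonzero multiples of the representatives are distinct nonzero vectors. *)
Lemma card_pg_points_bound :
  (#|{: pg_point F n}| * (#|F| - 1) <= #|F| ^ n.+1 - 1)%N.
Proof.
pose g (u : pg_point F n * F) := u.2 *: point_vector u.1.
pose D := setX [set: pg_point F n] [set~ (0 : F)].
have Dinj : {in D &, injective g}.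
  move=> [x a] [y b]; rewrite !inE /= => a0 b0 E.
  have xy : x = y.
    apply: point_eq; apply/vlineP; exists (a^-1 * b).
    by rewrite -scalerA -[b *: _]E scalerA mulVf // scale1r.
  move: E; rewrite /g xy /= => /eqP; rewrite -subr_eq0 -scalerBl scaler_eq0.
  by rewrite (negPf (point_vector_neq0 y)) orbF subr_eq0 => /eqP ->.
have cD : #|D| = (#|{: pg_point F n}| * (#|F| - 1))%N.
  by rewrite cardsX cardsT cardsC1 subn1.
rewrite -cD -(card_in_imset Dinj).
have -> : (#|F| ^ n.+1 - 1 = #|[set~ (0%R : 'rV[F]_n.+1)]|)%N.
  by rewrite cardsC1 card_mx mul1n subn1.
apply: subset_leq_card; apply/subsetP => _ /imsetP[[x a] + ->]; rewrite !inE /= => a0.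
by rewrite scaler_eq0 negb_or a0 point_vector_neq0.
Qed.

End PointVectors.

(** * From the number of colors to the excess *)

Lemma theta_recl (q k : nat) : (1 < q)%N -> (0 < k)%N ->
  theta q k = q%:R ^+ k + theta q k.-1.
Proof.
move=> q1 k0; rewrite /theta prednK // exprS.
have q10 : q%:R - 1 != 0 :> rat by rewrite subr_eq0 pnatr_eq1 neq_ltn q1 orbT.
by field.
Qed.

(** By the recursion for [theta], [d] is at most [2.005 q^k + theta q k.-1 - 5/2], and
    [theta q k.-1 <= q^k / 120]. *)
Lemma color_excess_bound (q n k X N d : nat) :
    (121 <= q)%N -> (0 < k)%N -> (X * (q - 1) <= q ^ n.+1 - 1)%N ->
    (theta q n - 2%:R * theta q k + 1 - delta q k <= N%:R)%R ->
    (d + N = X)%N ->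
  (100 * d + 200 <= 202 * q ^ k)%N.
Proof.
move=> q121 k0 Xq Nbig dNX; have q1 : (1 < q)%N by lia.
have q0R : 0 < q%:R - 1 :> rat by rewrite subr_gt0 ltr1n.
have XR : X%:R <= theta q n.
  rewrite /theta ler_pdivlMr //; move: Xq; rewrite -(ler_nat rat) natrM.
  have qn0 : (0 < q ^ n.+1)%N by rewrite expn_gt0 (ltnW q1).
  by rewrite (natrB _ qn0) (natrB _ (ltnW q1)) natrX.
have tk : 120%:R * theta q k.-1 <= q%:R ^+ k.
  rewrite /theta (prednK k0) mulrA (ler_pdivrMr _ _ q0R).
  have qk1 : 1 <= q%:R ^+ k :> rat by rewrite -natrX ler1n expn_gt0 (ltnW q1).
  have q121R : 121%:R <= q%:R :> rat by rewrite (ler_nat rat 121 q).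
  have := ler_wpM2l (le_trans ler01 qk1) q121R.
  move: (_ ^+ k) qk1 => Q; lra.
have : 100%:R * d%:R + 200%:R <= 202%:R * q%:R ^+ k :> rat.
  have Q0 : 0 <= q%:R ^+ k :> rat by rewrite exprn_ge0 // ler0n.
  move: Nbig XR; rewrite /delta (theta_recl q1 k0) -dNX natrD.
  lra.
by rewrite -natrX -!natrM -natrD ler_nat.
Qed.

(** * Transfer between the two fields and the final theorem *)

(** Each entry of [A] has coordinates, since an injection between sets of equal size is onto. One
    equation over [K] thus becomes [k] equations over [F]. *)
Lemma mulmx_coordinates_surjective (F K : finFieldType)
    (iota : {rmorphism F -> K}) (m k : nat) (b : 'cV[K]_k) :
    #|K| = (#|F| ^ k)%N ->
    (forall c : 'rV[F]_k, map_mx iota c *m b = 0 -> c = 0) ->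
  forall A : 'cV[K]_m, exists B : 'M[F]_(m, k), A = map_mx iota B *m b.
Proof.
move=> cK bfree A; pose g (c : 'rV[F]_k) : K := (map_mx iota c *m b) 0 0.
have g_inj : injective g.
  move=> c d cd; apply/eqP; rewrite -subr_eq0; apply/eqP/bfree.
  apply/matrixP => i j; rewrite !ord1 map_mxB mulmxBl mxE [X in _ + X]mxE.
  by rewrite [in RHS]mxE; apply/eqP; rewrite subr_eq0; apply/eqP.
have [g' _ gK] : bijective g.
  by apply: inj_card_bij => //; rewrite card_mx mul1n cK.
exists (\matrix_i g' (A i 0)); apply/matrixP => i j; rewrite ord1 -[LHS]gK /g.
by rewrite !mxE; apply: eq_bigr => l _; rewrite !mxE.
Qed.

Lemma rainbow_freeP (V : finType) (E P : {set {set V}}) :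
    partition P [set: V] -> rainbow_free E P ->
  forall e, e \in E -> exists2 C, C \in P & (1 < #|C :&: e|)%N.
Proof.
case/and3P => /eqP covP _ _ /forall_inP rf e /rf.
case/forall_inPn => x xe /forall_inPn[y ye].
rewrite negb_imply negbK => /andP[xy /eqP pxy].
have inP z : z \in cover P by rewrite covP inE.
exists (pblock P x); first by rewrite pblock_mem.
apply/card_gt1P; exists x, y; split=> //; rewrite inE ?xe ?ye andbT.
  by rewrite mem_pblock.
by rewrite pxy mem_pblock.
Qed.

Lemma sum_card_pred_partition (V : finType) (P : {set {set V}}) :
  partition P [set: V] -> ((\sum_(C in P) (#|C| - 1)) + #|P| = #|V|)%N.
Proof.
move=> partP; rewrite -cardsT (card_partition partP) -sum1_card -big_split /=.
apply: eq_bigr => C CP; rewrite subnK // card_gt0.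
by case/and3P: partP => _ _; apply: contraNneq => <-.
Qed.

Local Close Scope ring_scope.

Theorem theorem1p8 (n p h k N : nat) (F : finFieldType)
    (P : {set {set pg_point F n}}) :
  let q := p ^ h in
  2 <= n -> prime p -> 2 <= h -> #|F| = q -> 1 <= k <= n - 1 ->
  11 <= p -> 239 <= q ^ k ->
  strict_coloring N P ->
  rainbow_free (pg_hypergraph F n (n - k)) P ->
  (theta q n - 2%:R * theta q k + 1 - delta q k <= N%:R)%R ->
  exists2 C : {set pg_point F n},
    C \in P & two_transversal (pg_hypergraph F n (n - k)) C.
Proof.
move=> q n2 _ h2 cF /andP[k1 kn1] p11 _ /andP[partP /eqP cP] rf Nbig.
have kn : k <= n by rewrite (leq_trans kn1) // leq_subr.
(* Since [h >= 2], [q] is at least [11 ^ 2]. *)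
have q121 : 121 <= q.
  have p2 : 11 ^ 2 <= p ^ 2 by rewrite leq_exp2r.
  by apply: leq_trans p2 (leq_pexp2l _ h2); apply: leq_trans p11.
have [K [iota [b [cK bfree]]]] := finField_extension_coordinates F k1.
pose r (x : pg_point F n) := map_mx iota (point_vector x).
have r_neq0 x : r x != 0%R by rewrite map_mx_eq0 point_vector_neq0.
have r_free x y : x != y -> row_free (col_mx (r x) (r y)).
  by move=> xy; rewrite -map_col_mx row_free_map point_vector_free.
(* Independence of [b] over [F] makes the single equation over [K] equivalent to the [k] equations
   [B]. *)
have in_zeros_coord (B : 'M[F]_(n.+1, k)) x :
    (x \in zeros r (map_mx iota B *m b)) = (point_vector x *m B == 0)%R.
  rewrite inE mulmxA -map_mxM; apply/eqP/eqP => [/bfree //|->].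
  by rewrite map_mx0 mul0mx.
have [//|||C CP C2] := @functional_coloring _ _ _ r r_neq0 r_free P.
- by case/and3P: partP.
- move=> A; have [B ->] := mulmx_coordinates_surjective cK bfree A.
  have [U dU UB] := kernel_contains_pg_subspace B kn.
  have [|C CP C2] := rainbow_freeP partP rf (e := pg_points U).
    by apply/imsetP; exists U; rewrite // inE.
  exists C => //; rewrite (leq_trans C2) // subset_leq_card // setIS //.
  apply/subsetP => x; rewrite mem_pg_points in_zeros_coord => /UB ->.
  exact: eqxx.
- rewrite cK cF; apply: (color_excess_bound q121 k1 _ Nbig).
    by rewrite -cF; apply: card_pg_points_bound.
  by rewrite -cP sum_card_pred_partition.
exists C => //; apply/forall_inP => _ /imsetP[U + ->]; rewrite inE => dU.
(* Conversely, every hyperedge contains the zeros of some functional. *)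
have [B BU] := pg_subspace_kernel kn dU.
rewrite (leq_trans (C2 (map_mx iota B *m b)%R)) // subset_leq_card // setIS //.
by apply/subsetP => x; rewrite in_zeros_coord mem_pg_points => /eqP/BU.
Qed.
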